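(* Let $\mathcal{X},\mathcal{Y},\mathcal{Z}$ be topological spaces, let $k,l,m$ be kernels (real-valued symmetric positive definite functions) on $\mathcal{X},\mathcal{Y},\mathcal{Z}$ respectively, and let $(X_i,Y_i,Z_i)_{i=1}^n$, $n\ge 1$, be sample points in $\mathcal{X}\times\mathcal{Y}\times\mathcal{Z}$. Let $\hat P_{XYZ}$ be the empirical measure of the sample, with marginals $\hat P_X,\hat P_Y,\hat P_Z$, and let $\Delta_{tot}\hat P=\hat P_{XYZ}-\hat P_X\hat P_Y\hat P_Z$. Let $K,L,M$ be the $n\times n$ Gram matrices $K_{ij}=k(X_i,X_j)$, $L_{ij}=l(Y_i,Y_j)$, $M_{ij}=m(Z_i,Z_j)$. Then $$\left\Vert \Delta_{tot}\hat P\right\Vert_{k\otimes l\otimes m}^2=\frac{1}{n^2}\left(K\circ L\circ M\right)_{++}-\frac{2}{n^4}\operatorname{tr}(K_+\circ L_+\circ M_+)+\frac{1}{n^6}K_{++}L_{++}M_{++}.$$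
   Context: $\circ$ denotes the Hadamard (entrywise) product of matrices, and $A_{++}=\sum_{i=1}^n\sum_{j=1}^n A_{ij}$ is the sum of all entries of an $n\times n$ matrix $A$. For a symmetric $n\times n$ matrix $K$, $K_+=\mathbf 1\mathbf 1^\top K$, where $\mathbf 1$ is the $n\times1$ column of ones; that is, $[K_+]_{ij}=\sum_{a=1}^nK_{aj}$. A kernel on a set is a symmetric function $k$ with $\sum_{i,j}a_ia_jk(x_i,x_j)\ge0$ for all finite families of real $a_i$ and points $x_i$. The product kernel is $(k\otimes l\otimes m)\big((x,y,z),(x',y',z')\big)=k(x,x')\,l(y,y')\,m(z,z')$. For a kernel $\kappa$ on a space and a finite signed measure $\nu$ on it whose kernel embedding $\mu_\kappa(\nu)=\int\kappa(\cdot,w)\,d\nu(w)$ in the reproducing kernel Hilbert space $\mathcal H_\kappa$ exists, $\|\nu\|_\kappa^2:=\|\mu_\kappa(\nu)\|_{\mathcal H_\kappa}^2=\iint\kappa(w,w')\,d\nu(w)\,d\nu(w')$. For finitely supported $\nu$ (as here) these integrals are finite sums. The empirical measure is $\hat P_{XYZ}=\frac1n\sum_{i=1}^n\delta_{(X_i,Y_i,Z_i)}$, with marginals $\hat P_X=\frac1n\sum_i\delta_{X_i}$, $\hat P_Y=\frac1n\sum_i\delta_{Y_i}$, $\hat P_Z=\frac1n\sum_i\delta_{Z_i}$; $\hat P_X\hat P_Y\hat P_Z$ is their product measure on $\mathcal X\times\mathcal Y\times\mathcal Z$. *)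

(* Defs.v *)
From HB Require Import structures.
From mathcomp Require Import all_boot all_order all_algebra.
From mathcomp Require Import sesquilinear.
From mathcomp Require Import all_classical all_reals all_analysis.

Set Implicit Arguments.
Unset Strict Implicit.
Unset Printing Implicit Defensive.

Import Order.TTheory GRing.Theory Num.Theory.
Import numFieldNormedType.Exports.
Local Open Scope classical_set_scope.
Local Open Scope ring_scope.

Definition posdef_kernel (R : realType) (W : Type) (kappa : W -> W -> R) :=
  (forall w w', kappa w w' = kappa w' w) /\
  (forall (N : nat) (a : 'I_N -> R) (w : 'I_N -> W),
     0 <= \sum_(i < N) \sum_(j < N) a i * a j * kappa (w i) (w j)).

Definition tensor_kernel3 (R : realType) (X Y Z : Type)
    (k : X -> X -> R) (l : Y -> Y -> R) (m : Z -> Z -> R)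
    (w w' : X * Y * Z) : R :=
  k w.1.1 w'.1.1 * l w.1.2 w'.1.2 * m w.2 w'.2.

(* A Hilbert space of functions on W reproduced by kappa.  Its elements are    *)
(* points h of an abstract complete normed space, identified with functions    *)
(* through the injective linear map rkhs_fun; rkhs_feature w is the element    *)
(* kappa(., w).                                                                *)
Record rkhs (R : realType) (W : Type) (kappa : W -> W -> R) := RKHS {
  rkhs_space :> completeNormedModType R ;
  rkhs_dot : {dot rkhs_space for idfun} ;
  rkhs_normE : forall h : rkhs_space, `|h| ^+ 2 = rkhs_dot h h ;
  rkhs_fun : {linear rkhs_space -> (W -> R)} ;
  rkhs_fun_inj : injective rkhs_fun ;
  rkhs_feature : W -> rkhs_space ;
  rkhs_featureE : forall w w', rkhs_fun (rkhs_feature w) w' = kappa w' w ;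
  rkhs_reproducing : forall (h : rkhs_space) w,
    rkhs_dot h (rkhs_feature w) = rkhs_fun h w }.

(* A finitely supported signed measure on W is given by its mass function      *)
(* nu : W -> R, nu w being the mass of the point w.  Integrals against it are  *)
(* the finite sums \sum_(w \in setT), which range over the points where the    *)
(* summand does not vanish.                                                    *)

Definition dirac_mass (R : realType) (W : Type) (a : W) : W -> R := \1_[set a].

Definition empirical (R : realType) (W : Type) (n : nat) (w : 'I_n -> W) :
    W -> R :=
  n%:R^-1 *: \sum_(i < n) dirac_mass R (w i).

Definition product_measure3 (R : realType) (X Y Z : Type)
    (p : X -> R) (q : Y -> R) (r : Z -> R) (w : X * Y * Z) : R :=
  p w.1.1 * q w.1.2 * r w.2.

Definition double_integral (R : realType) (W : choiceType)
    (kappa : W -> W -> R) (nu : W -> R) : R :=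
  \sum_(w \in [set: W]) \sum_(w' \in [set: W]) kappa w w' * nu w * nu w'.

Definition mean_embedding (R : realType) (W : choiceType)
    (kappa : W -> W -> R) (H : rkhs kappa) (nu : W -> R) : H :=
  \sum_(w \in [set: W]) nu w *: rkhs_feature H w.

Definition Delta_tot (R : realType) (X Y Z : Type) (n : nat)
    (x : 'I_n -> X) (y : 'I_n -> Y) (z : 'I_n -> Z) : X * Y * Z -> R :=
  empirical R (fun i => (x i, y i, z i))
  - product_measure3 (empirical R x) (empirical R y) (empirical R z).

Definition gram (R : realType) (W : Type) (n : nat)
    (kappa : W -> W -> R) (w : 'I_n -> W) : 'M[R]_n :=
  \matrix_(i, j) kappa (w i) (w j).

Definition hadamard (R : realType) (n : nat) (A B : 'M[R]_n) : 'M[R]_n :=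
  map2_mx *%R A B.

Definition entry_sum (R : realType) (n : nat) (A : 'M[R]_n) : R :=
  \sum_(i < n) \sum_(j < n) A i j.

Definition ones (R : realType) (n : nat) : 'cV[R]_n := const_mx 1.

Definition plus_mx (R : realType) (n : nat) (A : 'M[R]_n) : 'M[R]_n :=
  ones R n *m (ones R n)^T *m A.

(* Main.v *)
(* Delta_tot is a finite combination of point masses: weight 1/n at each sample
   point and -1/n^3 at each of the n^3 points of the product grid.  Both the
   squared norm and the double integral are then the same quadratic form in
   these weights; its sample-sample, sample-grid (twice, by symmetry) and
   grid-grid parts are the three terms of the formula. *)

Require Import Defs.
From HB Require Import structures.
From mathcomp Require Import all_boot all_order all_algebra.
From mathcomp Require Import sesquilinear ring.
From mathcomp Require Import all_classical all_reals all_analysis.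

Import Order.TTheory GRing.Theory Num.Theory.
Import numFieldNormedType.Exports.
Local Open Scope ring_scope.

(** The points [p i] may coincide, in which case their weights add up; samples with ties are thus
    covered. *)
Definition atomic_measure (R : realType) (W : Type) (I : finType)
    (c : I -> R) (p : I -> W) : W -> R :=
  \sum_i c i *: dirac_mass R (p i).

Arguments atomic_measure {R W I} c p _.

(** The sum over [W] reduces to the finite list of atoms; after exchanging sums, index [i]
    contributes only at [w = p i]. Values in a module [V] cover both real integrals and the mean
    embedding. *)
Lemma fsum_atomic_measure (R : realType) (W : choiceType) (I : finType)
    (V : lmodType R) (c : I -> R) (p : I -> W) (F : W -> V) :
  \sum_(w \in [set: W]) atomic_measure c p w *: F w = \sum_i c i *: F (p i).
Proof.
(* Duplicates are removed so that each point of the support is summed over once. *)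
pose s := undup [seq p i | i <- enum I].
have mem_s i : p i \in s by rewrite mem_undup map_f ?mem_enum.
have atomicE w : atomic_measure c p w = \sum_i c i * (w == p i)%:R.
  rewrite /atomic_measure fct_sumE; apply: eq_bigr => i _.
  by rewrite /dirac_mass /= fctE indicE in_set1.
rewrite (fsbigE s) ?undup_uniq//; last first.
  move=> w _ ws; rewrite atomicE big1 ?scale0r// => i _.
  have [wp|_] := eqVneq w (p i); last by rewrite mulr0.
  by rewrite wp mem_s in ws.
under eq_bigl do rewrite in_setT.
under eq_bigr do rewrite atomicE scaler_suml.
rewrite exchange_big; apply: eq_bigr => i _ /=.
rewrite (bigD1_seq (p i)) ?undup_uniq//= eqxx mulr1 big1 ?addr0// => w.
by move=> /negPf ->; rewrite mulr0 scale0r.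
Qed.

Lemma double_integral_atomic_measure (R : realType) (W : choiceType)
    (I : finType) (kappa : W -> W -> R) (c : I -> R) (p : I -> W) :
  double_integral kappa (atomic_measure c p) =
  \sum_i \sum_j c i * c j * kappa (p i) (p j).
Proof.
set nu := atomic_measure c p; rewrite /double_integral.
transitivity (\sum_(w \in [set: W])
    nu w *: (\sum_j c j * kappa w (p j) : R^o)).
  apply: eq_fsbigr => w _ /=.
  rewrite -(fsum_atomic_measure _ _ _ R^o c p (kappa w)) -/nu.
  rewrite [RHS]mulr_fsumr; apply: eq_fsbigr => w' _.
  by rewrite /GRing.scale/=; ring.
rewrite fsum_atomic_measure; apply: eq_bigr => i _.
by rewrite [LHS]mulr_sumr; apply: eq_bigr => j _; rewrite mulrA.
Qed.

Lemma sqr_norm_mean_embedding_atomic (R : realType) (W : choiceType)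
    (I : finType) (kappa : W -> W -> R) (H : rkhs kappa)
    (c : I -> R) (p : I -> W) :
  `|mean_embedding H (atomic_measure c p)| ^+ 2 =
  \sum_i \sum_j c i * c j * kappa (p i) (p j).
Proof.
rewrite rkhs_normE /mean_embedding fsum_atomic_measure linear_sumlz.
(* The reproducing property yields [kappa] with its arguments reversed; exchanging the sums on the
   right gives the same order. *)
rewrite [RHS]exchange_big/=.
apply: eq_bigr => i _; rewrite linear_sumr; apply: eq_bigr => j _.
rewrite linearZl_LR linearZr_LR/=. rewrite rkhs_reproducing rkhs_featureE.
by rewrite mulrA [c i * _]mulrC.
Qed.

Lemma sum_prod3 (R : comNzRingType) (I J K : finType)
    (f : I -> R) (g : J -> R) (h : K -> R) :
  \sum_(t : I * J * K) f t.1.1 * g t.1.2 * h t.2 =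
  (\sum_i f i) * (\sum_j g j) * (\sum_k h k).
Proof.
rewrite -(pair_bigA _ (fun s k => f s.1 * g s.2 * h k))/=.
rewrite -(pair_bigA _ (fun i j => \sum_k f i * g j * h k))/=.
rewrite big_distrlr big_distrl; apply: eq_bigr => i _ /=.
rewrite big_distrl; apply: eq_bigr => j _ /=.
by rewrite big_distrr.
Qed.

(** [inl] indexes the sample points, [inr] the grid of triples. A sample point also lies on the grid
    and is kept as two atoms. *)
Definition Delta_weight (R : realType) (n : nat)
    (s : 'I_n + 'I_n * 'I_n * 'I_n) : R :=
  if s is inl _ then n%:R^-1 else - n%:R^-1 ^+ 3.

Definition Delta_point (X Y Z : Type) (n : nat)
    (x : 'I_n -> X) (y : 'I_n -> Y) (z : 'I_n -> Z)
    (s : 'I_n + 'I_n * 'I_n * 'I_n) : X * Y * Z :=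
  match s with
  | inl i => (x i, y i, z i)
  | inr t => (x t.1.1, y t.1.2, z t.2)
  end.

Arguments Delta_point {X Y Z n} x y z s.

Lemma Delta_tot_atomic (R : realType) (X Y Z : choiceType) (n : nat)
    (x : 'I_n -> X) (y : 'I_n -> Y) (z : 'I_n -> Z) :
  Delta_tot R x y z =
  atomic_measure (Delta_weight R n) (Delta_point x y z).
Proof.
apply/funext => w; rewrite /Delta_tot /atomic_measure big_sumType/=.
rewrite -!scaler_sumr scaleNr; congr (_ - _).
rewrite /product_measure3 /empirical /= !fctE !fct_sumE.
rewrite [LHS](_ : _ = n%:R^-1 ^+ 3 * ((\sum_i dirac_mass R (x i) w.1.1) *
  (\sum_i dirac_mass R (y i) w.1.2) * (\sum_i dirac_mass R (z i) w.2))).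
  rewrite -sum_prod3; congr (_ * _); apply: eq_bigr => t _.
  (* A product of three indicators is the indicator of the conjunction, and equality of triples is
     coordinatewise. *)
  rewrite /dirac_mass !indicE -!natrM !mulnb; congr (nat_of_bool _)%:R.
  case: w => -[a b] d /=; rewrite !in_set1.
  by rewrite !xpair_eqE.
by rewrite /GRing.scale/=; ring.
Qed.

(** Every row of [plus_mx A] is the vector of column sums of [A]. *)
Lemma tr_hadamard_plus_mx (R : realType) (n : nat) (A B C : 'M[R]_n) :
  \tr (hadamard (hadamard (plus_mx A) (plus_mx B)) (plus_mx C)) =
  \sum_i (\sum_a A a i) * (\sum_a B a i) * (\sum_a C a i).
Proof.
have plus_mxE (D : 'M[R]_n) i j : plus_mx D i j = \sum_a D a j.
  rewrite /plus_mx -mulmxA mxE big_ord1 !mxE mul1r.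
  by apply: eq_bigr => a _; rewrite !mxE mul1r.
have hadamardE (D E : 'M[R]_n) i j : hadamard D E i j = D i j * E i j.
  by rewrite mxE.
by apply: eq_bigr => i _; rewrite !hadamardE !plus_mxE.
Qed.

Lemma quadratic_form_Delta (R : realType) (X Y Z : Type)
    (k : X -> X -> R) (l : Y -> Y -> R) (m : Z -> Z -> R)
    (symk : forall a b, k a b = k b a) (syml : forall a b, l a b = l b a)
    (symm : forall a b, m a b = m b a)
    (n : nat) (x : 'I_n -> X) (y : 'I_n -> Y) (z : 'I_n -> Z) :
  let c := Delta_weight R n in
  let p := Delta_point x y z in
  let K := gram k x in
  let L := gram l y in
  let M := gram m z in
  \sum_s \sum_t c s * c t * tensor_kernel3 k l m (p s) (p t) =
  1 / n%:R ^+ 2 * entry_sum (hadamard (hadamard K L) M)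
  - 2 / n%:R ^+ 4 *
      \tr (hadamard (hadamard (plus_mx K) (plus_mx L)) (plus_mx M))
  + 1 / n%:R ^+ 6 * (entry_sum K * entry_sum L * entry_sum M).
Proof.
move=> c p K L M; set N : R := n%:R^-1.
pose T := \tr (hadamard (hadamard (plus_mx K) (plus_mx L)) (plus_mx M)).
have KE i j : K i j = k (x i) (x j) by rewrite mxE.
have LE i j : L i j = l (y i) (y j) by rewrite mxE.
have ME i j : M i j = m (z i) (z j) by rewrite mxE.
have diag : \sum_i \sum_j c (inl i) * c (inl j) *
      tensor_kernel3 k l m (p (inl i)) (p (inl j)) =
    N ^+ 2 * entry_sum (hadamard (hadamard K L) M).
  rewrite mulr_sumr; apply: eq_bigr => i _.
  by rewrite mulr_sumr; apply: eq_bigr => j _; rewrite !mxE expr2.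
(* For a fixed sample index [i], the sum over the grid factors into three column sums of Gram
   matrices, once symmetry turns [k (x i) (x a)] into [K a i]. *)
have cross : \sum_i \sum_t c (inl i) * c (inr t) *
      tensor_kernel3 k l m (p (inl i)) (p (inr t)) = - N ^+ 4 * T.
  rewrite /T tr_hadamard_plus_mx mulr_sumr; apply: eq_bigr => i _.
  rewrite -sum_prod3 mulr_sumr; apply: eq_bigr => t _.
  rewrite /tensor_kernel3 /= -/N KE LE ME (symk (x i)) (syml (y i)).
  by rewrite (symm (z i)); ring.
have prod : \sum_s \sum_t c (inr s) * c (inr t) *
      tensor_kernel3 k l m (p (inr s)) (p (inr t)) =
    N ^+ 6 * (entry_sum K * entry_sum L * entry_sum M).
  (* The factorization is used twice: for the outer grid point on row sums, then for the inner one
     on entries. *)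
  rewrite -sum_prod3 mulr_sumr; apply: eq_bigr => s _.
  rewrite -sum_prod3 mulr_sumr; apply: eq_bigr => t _.
  by rewrite /tensor_kernel3 /= -/N KE LE ME; ring.
have cross' : \sum_t \sum_i c (inr t) * c (inl i) *
      tensor_kernel3 k l m (p (inr t)) (p (inl i)) = - N ^+ 4 * T.
  rewrite exchange_big -cross; apply: eq_bigr => i _; apply: eq_bigr => t _.
  rewrite [c (inr t) * _]mulrC /tensor_kernel3.
  by congr (_ * (_ * _ * _)); [exact: symk|exact: syml|exact: symm].
(* Splitting both indices gives four blocks; the two equal cross blocks produce the factor 2. *)
under eq_bigr do rewrite big_sumType.
rewrite big_sumType !big_split/= diag cross cross' prod -/T.
by rewrite !div1r -!exprVn -/N; ring.
Qed.

Theorem proposition5 (R : realType) (X Y Z : topologicalType)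
    (k : X -> X -> R) (l : Y -> Y -> R) (m : Z -> Z -> R)
    (hk : posdef_kernel k) (hl : posdef_kernel l) (hm : posdef_kernel m)
    (n : nat) (hn : (1 <= n)%N)
    (x : 'I_n -> X) (y : 'I_n -> Y) (z : 'I_n -> Z) :
  let klm := tensor_kernel3 k l m in
  let Delta := Delta_tot R x y z in
  let K := gram k x in
  let L := gram l y in
  let M := gram m z in
  let rhs :=
    1 / n%:R ^+ 2 * entry_sum (hadamard (hadamard K L) M)
    - 2 / n%:R ^+ 4 *
        \tr (hadamard (hadamard (plus_mx K) (plus_mx L)) (plus_mx M))
    + 1 / n%:R ^+ 6 * (entry_sum K * entry_sum L * entry_sum M) in
  (forall H : rkhs klm, `|mean_embedding H Delta| ^+ 2 = rhs) /\
  double_integral klm Delta = rhs.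
Proof.
move=> klm Delta K L M rhs.
have rhsE := quadratic_form_Delta _ _ _ _ _ _ _
  (proj1 hk) (proj1 hl) (proj1 hm) _ x y z.
rewrite /Delta Delta_tot_atomic; split=> [H|].
  by rewrite sqr_norm_mean_embedding_atomic rhsE.
by rewrite double_integral_atomic_measure rhsE.
Qed.
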